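(* For every countable graph $G$ not containing $K_\omega$ as a subgraph there exists a countable rigid graph $G'$ containing $G$ as an induced subgraph.
   Context: All graphs are simple, undirected and loopless. A homomorphism is a vertex map preserving edges. A graph $G'$ is rigid if the identity map is its only homomorphism $G' \to G'$. $K_\omega$ denotes the countably infinite complete graph. *)

(* Defs.v *)
Record graph := Graph {
  vert : Type;
  adj : vert -> vert -> Prop;
  adj_sym : forall x y, adj x y -> adj y x;
  adj_irrefl : forall x, ~ adj x x
}.

Definition countable_graph (G : graph) : Prop :=
  exists f : vert G -> nat, forall x y, f x = f y -> x = y.

Definition is_hom (G H : graph) (f : vert G -> vert H) : Prop :=
  forall x y, adj G x y -> adj H (f x) (f y).

Definition rigid (G : graph) : Prop :=
  forall f : vert G -> vert G, is_hom G G f -> forall x, f x = x.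

Definition contains_Komega (G : graph) : Prop :=
  exists g : nat -> vert G,
    (forall i j, g i = g j -> i = j) /\
    (forall i j, i <> j -> adj G (g i) (g j)).

Definition induced_subgraph (G H : graph) : Prop :=
  exists e : vert G -> vert H,
    (forall x y, e x = e y -> x = y) /\
    (forall x y, adj G x y <-> adj H (e x) (e y)).

(* Main.v *)
(** Let [step X] be the join of [X] with the graph of finite cliques of [X],
    two cliques being adjacent when one properly extends the other.  If [X]
    has no infinite clique then neither has [step X], and there is no
    homomorphism [f] from [step X] to [X], since
    [f(), f(f()), f(f(), f(f())), ...] would be an infinite clique.

    Let [H n] be the [n+2]-fold iterate of [step] on [G], so that [H n] does
    not map to [H k] for [k < n].  Hang these pieces on one another in a tree:
    the root of piece [n+1] is joined to a vertex of some earlier piece by a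
    path of length [n+2], so that infinitely many pieces hang at every vertex.
    Every edge of a piece lies in a triangle and the paths lie in none, so an
    endomorphism sends pieces into pieces, never to one of smaller index.
    As piece [k+1] is at distance at least [k+2] from all the others, with
    equality only along the path to its parent, a path of length [n+2] whose
    ends go to different pieces must be fixed pointwise.  At each vertex some
    piece of large enough index hangs to which this applies. *)

From Stdlib Require Import Arith Lia List Cantor Eqdep_dec Classical FinFun.
From Stdlib Require Import IndefiniteDescription.
Require Import Defs.
Import ListNotations.

(** * Countable types *)

Definition countable (T : Type) : Prop :=
  exists f : T -> nat, forall x y, f x = f y -> x = y.

Lemma to_nat_inj p q : to_nat p = to_nat q -> p = q.
Proof.
  intros E. rewrite <- (cancel_of_to p), <- (cancel_of_to q). now rewrite E.
Qed.

Lemma countable_sum A B : countable A -> countable B -> countable (A + B).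
Proof.
  intros [f Hf] [g Hg].
  exists (fun s => match s with inl a => to_nat (0, f a) | inr b => to_nat (1, g b) end).
  intros [a|b] [a'|b'] E; apply to_nat_inj in E; injection E; intros;
    try discriminate; f_equal; auto.
Qed.

Lemma countable_nat_prod : countable (nat * nat).
Proof. exists to_nat. exact to_nat_inj. Qed.

Lemma countable_list A : countable A -> countable (list A).
Proof.
  intros [f Hf].
  exists (fix code l := match l with [] => 0 | a :: l => S (to_nat (f a, code l)) end).
  induction x as [|a l IH]; destruct y as [|b l']; intros E; try discriminate; auto.
  apply eq_add_S, to_nat_inj in E. injection E. intros E2 E1.
  f_equal; auto.
Qed.

Lemma countable_sig A (P : A -> Prop) : countable A -> countable {a | P a}.
Proof.
  intros [f Hf]. exists (fun a => f (proj1_sig a)).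
  intros [a p] [b q] E; simpl in E. apply Hf in E. subst b.
  f_equal. apply proof_irrelevance.
Qed.

Lemma countable_sigT (A : nat -> Type) :
  (forall n, countable (A n)) -> countable {n & A n}.
Proof.
  intros H.
  set (f := fun n => proj1_sig (constructive_indefinite_description _ (H n))).
  assert (Hf : forall n x y, f n x = f n y -> x = y)
    by (intros n; exact (proj2_sig (constructive_indefinite_description _ (H n)))).
  exists (fun s => to_nat (projT1 s, f (projT1 s) (projT2 s))).
  intros [n x] [m y] E. apply to_nat_inj in E.
  injection E. intros E2 E1. subst m. f_equal. now apply Hf.
Qed.

Lemma countable_enum A (a0 : A) :
  countable A -> exists e : nat -> A, forall a, exists n, e n = a.
Proof.
  intros [f Hf].
  (* The relation is vacuous when [n] is not in the range of [f], where [a0] serves as default. *)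
  destruct (functional_choice (fun n a => forall b, f b = n -> a = b)) as [e He].
  - intros n. destruct (classic (exists b, f b = n)) as [[b Hb]|N].
    + exists b. intros c Hc. apply Hf. congruence.
    + exists a0. intros b Hb. exfalso. eauto.
  - exists e. intros a. exists (f a). now apply He.
Qed.

(** * Infinite cliques *)

Lemma Komega_of_lt G (g : nat -> vert G) :
  (forall i j, i < j -> adj G (g i) (g j)) -> contains_Komega G.
Proof.
  intros H. exists g.
  assert (H' : forall i j, i <> j -> adj G (g i) (g j)).
  { intros i j N. destruct (Nat.lt_total i j) as [L|[E|L]]; [auto|tauto|].
    apply adj_sym. auto. }
  split; [|exact H'].
  intros i j E. destruct (Nat.eq_dec i j) as [|N]; [assumption|].
  exfalso. apply (adj_irrefl G (g i)). rewrite E at 2. auto.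
Qed.

Lemma frequently_subseq (P : nat -> Prop) :
  (forall N, exists i, N <= i /\ P i) ->
  exists h : nat -> nat, (forall n m, n < m -> h n < h m) /\ forall n, P (h n).
Proof.
  intros H. apply functional_choice in H. destruct H as [next Hn].
  set (h := fix h n := match n with 0 => next 0 | S n => next (S (h n)) end).
  exists h. split.
  - intros n m L. induction L as [|m L IH]; simpl.
    + apply (Hn (S (h n))).
    + pose proof (proj1 (Hn (S (h m)))). lia.
  - intros [|n]; apply Hn.
Qed.

Lemma injective_nat_unbounded (h : nat -> nat) :
  Injective h -> forall n, exists i, n < h i.
Proof.
  intros Hh n. apply NNPP. intros N.
  assert (B : forall i, h i <= n)
    by (intros i; apply Nat.nlt_ge; intros L; eauto).
  assert (L : length (map h (seq 0 (S (S n)))) <= length (seq 0 (S n))).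
  { apply NoDup_incl_length.
    - apply Injective_map_NoDup; [assumption|apply seq_NoDup].
    - intros y Hy. apply in_map_iff in Hy. destruct Hy as [i [<- _]].
      apply in_seq. specialize (B i). lia. }
  rewrite length_map, !length_seq in L. lia.
Qed.

(** * The graph of finite cliques *)

(** Cliques are ordered, so that extension means being a proper initial segment; irreflexivity rules
    out repetitions. *)
Definition clique (X : graph) (l : list (vert X)) : Prop :=
  forall i j a b, i < j -> nth_error l i = Some a -> nth_error l j = Some b -> adj X a b.

Definition extends {A : Type} (s t : list A) : Prop := exists u, u <> [] /\ t = s ++ u.

Lemma extends_length A (s t : list A) : extends s t -> length s < length t.
Proof.
  intros [u [N ->]]. rewrite length_app. destruct u; [tauto|simpl; lia].
Qed.

Lemma extends_trans A (s t r : list A) : extends s t -> extends t r -> extends s r.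
Proof.
  intros [u [Nu ->]] [v [Nv ->]]. exists (u ++ v). rewrite app_assoc. split; [|auto].
  destruct u; [tauto|discriminate].
Qed.

Lemma extends_snoc A (s : list A) a : extends s (s ++ [a]).
Proof. exists [a]. split; [discriminate|reflexivity]. Qed.

Lemma extends_nth_error A (s t : list A) n a :
  extends s t -> nth_error s n = Some a -> nth_error t n = Some a.
Proof.
  intros [u [_ ->]] E. rewrite nth_error_app1; [assumption|].
  apply nth_error_Some. congruence.
Qed.

Definition clique_graph (X : graph) : graph.
Proof.
  refine (Graph {l | clique X l}
    (fun s t => extends (proj1_sig s) (proj1_sig t) \/ extends (proj1_sig t) (proj1_sig s)) _ _).
  - tauto.
  - intros s [E|E]; apply extends_length in E; lia.
Defined.

Definition empty_clique (X : graph) : vert (clique_graph X).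
Proof. exists []. intros [|i] j a b _ E; discriminate. Defined.

Lemma clique_graph_neighbour X (x : vert X) (s : vert (clique_graph X)) :
  exists t, adj (clique_graph X) s t.
Proof.
  destruct s as [[|a l] Hs].
  - assert (Hx : clique X [x]) by (intros [|i] [|[|j]] a b L E E'; now try lia).
    exists (exist _ [x] Hx). left. apply (extends_snoc _ []).
  - exists (empty_clique X). right. exists (a :: l). split; [discriminate|reflexivity].
Qed.

(** The members of an infinite clique are comparable, hence of distinct and so unbounded lengths;
    their union is an infinite clique of [X]. *)
Lemma clique_graph_Komega_free X :
  ~ contains_Komega X -> ~ contains_Komega (clique_graph X).
Proof.
  intros HX [g [_ Hg]]. apply HX.
  assert (Hlen : Injective (fun i => length (proj1_sig (g i)))).
  { intros i j E. destruct (Nat.eq_dec i j) as [|N]; [assumption|].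
    destruct (Hg i j N) as [L|L]; apply extends_length in L; lia. }
  assert (HE : forall n, exists a, exists i, nth_error (proj1_sig (g i)) n = Some a).
  { intros n. destruct (injective_nat_unbounded _ Hlen n) as [i Hi].
    apply nth_error_Some in Hi.
    destruct (nth_error (proj1_sig (g i)) n) as [a|] eqn:E; [eauto|tauto]. }
  apply functional_choice in HE. destruct HE as [x Hx].
  apply (Komega_of_lt X x). intros n m L.
  destruct (Hx n) as [i Hi], (Hx m) as [j Hj].
  destruct (Nat.eq_dec i j) as [->|N].
  - exact (proj2_sig (g j) n m _ _ L Hi Hj).
  - destruct (Hg i j N) as [E|E].
    + apply (proj2_sig (g j) n m); auto. eapply extends_nth_error; eauto.
    + apply (proj2_sig (g i) n m); auto. eapply extends_nth_error; eauto.
Qed.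

Lemma clique_graph_no_hom X (f : vert (clique_graph X) -> vert X) :
  is_hom (clique_graph X) X f -> contains_Komega X.
Proof.
  intros Hf.
  (* Invariant: each entry of [c] is [f t] for a proper initial segment [t] of [c]. Then [t] is
     adjacent to [c], so [f t] is adjacent to [f c], and [f c] can be appended. *)
  set (good := fun c : vert (clique_graph X) => forall a, In a (proj1_sig c) ->
         exists t, a = f t /\ extends (proj1_sig t) (proj1_sig c)).
  assert (Hnext : forall c : {c | good c}, exists d : {d | good d},
            proj1_sig (proj1_sig d) = proj1_sig (proj1_sig c) ++ [f (proj1_sig c)]).
  { intros [c Hc]; simpl.
    assert (Hd : clique X (proj1_sig c ++ [f c])).
    { intros i j a b L Ei Ej.
      assert (Lj : j < length (proj1_sig c ++ [f c])) by (apply nth_error_Some; congruence).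
      rewrite length_app in Lj; simpl in Lj.
      rewrite nth_error_app1 in Ei by lia.
      destruct (Nat.eq_dec j (length (proj1_sig c))) as [->|N].
      - rewrite nth_error_app2, Nat.sub_diag in Ej by lia. injection Ej as <-.
        destruct (Hc a (nth_error_In _ _ Ei)) as [t [-> Et]].
        apply Hf. now left.
      - rewrite nth_error_app1 in Ej by lia. exact (proj2_sig c i j a b L Ei Ej). }
    assert (Gd : good (exist _ _ Hd)).
    { intros a Ha; simpl in *. apply in_app_or in Ha. destruct Ha as [Ha|[<-|[]]].
      - destruct (Hc a Ha) as [t [Ea Et]]. exists t. split; [assumption|].
        eapply extends_trans; [exact Et|apply extends_snoc].
      - exists c. split; [reflexivity|apply extends_snoc]. }
    now exists (exist _ _ Gd). }
  apply functional_choice in Hnext. destruct Hnext as [next Hnext].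
  assert (G0 : good (empty_clique X)) by (intros a []).
  set (s := fix s n := match n with 0 => exist good _ G0 | S n => next (s n) end).
  apply (Komega_of_lt X (fun n => f (proj1_sig (s n)))).
  intros n m L. apply Hf. left.
  assert (Hs : forall k, extends (proj1_sig (proj1_sig (s k))) (proj1_sig (proj1_sig (s (S k))))).
  { intros k. simpl. rewrite Hnext. apply extends_snoc. }
  induction L as [|m L IH]; [apply Hs|].
  eapply extends_trans; [exact IH|apply Hs].
Qed.

(** * Joining a graph with its graph of cliques *)

Definition step (X : graph) : graph.
Proof.
  refine (Graph (vert X + vert (clique_graph X))
    (fun s t => match s, t with
       | inl x, inl y => adj X x y
       | inr c, inr d => adj (clique_graph X) c d
       | _, _ => True
       end) _ _).
  - intros [x|c] [y|d]; auto using adj_sym.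
  - intros [x|c]; [apply adj_irrefl|apply (adj_irrefl (clique_graph X))].
Defined.

(** Used twice: for adjacent vertices it gives triangles, and for arbitrary ones it keeps the image
    of a piece inside one piece. *)
Lemma step_common_neighbour X (x0 : vert X) (u v : vert (step X)) :
  exists w, adj (step X) u w /\ adj (step X) v w.
Proof.
  destruct u as [x|c], v as [y|d].
  - now exists (inr (empty_clique X)).
  - destruct (clique_graph_neighbour X x0 d) as [t Ht]. now exists (inr t).
  - destruct (clique_graph_neighbour X x0 c) as [t Ht]. now exists (inr t).
  - now exists (inl x0).
Qed.

(** An infinite clique either meets the clique side infinitely often or has a tail inside [X]. *)
Lemma step_Komega_free X : ~ contains_Komega X -> ~ contains_Komega (step X).
Proof.
  intros HX [g [_ Hg]].
  destruct (classic (forall N, exists i, N <= i /\ exists c, g i = inr c)) as [F|F].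
  - apply frequently_subseq in F. destruct F as [h [Hh Hc]].
    apply functional_choice in Hc. destruct Hc as [c Hc].
    apply (clique_graph_Komega_free X HX), (Komega_of_lt (clique_graph X) c).
    intros i j L. specialize (Hh i j L).
    assert (A := Hg (h i) (h j) ltac:(lia)). rewrite !Hc in A. exact A.
  - apply not_all_ex_not in F. destruct F as [N F]. apply HX.
    assert (Hx : forall n, exists x, g (N + n) = inl x).
    { intros n. destruct (g (N + n)) as [x|c] eqn:E; [eauto|].
      exfalso. apply F. exists (N + n). split; [lia|eauto]. }
    apply functional_choice in Hx. destruct Hx as [x Hx].
    apply (Komega_of_lt X x). intros i j L.
    assert (A := Hg (N + i) (N + j) ltac:(lia)). rewrite !Hx in A. exact A.
Qed.

Lemma step_countable X : countable_graph X -> countable_graph (step X).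
Proof. intros H. now apply countable_sum, countable_sig, countable_list. Qed.

Lemma step_no_hom X (f : vert (step X) -> vert X) :
  is_hom (step X) X f -> contains_Komega X.
Proof.
  intros Hf. apply (clique_graph_no_hom X (fun c => f (inr c))).
  intros c d A. apply Hf. exact A.
Qed.

(** * Iterating the join *)

Fixpoint tower (G : graph) (n : nat) : graph :=
  match n with 0 => step G | S n => step (tower G n) end.

(** The empty clique is available even when [G] has no vertices. *)
Definition tower_root (G : graph) (n : nat) : vert (tower G n) :=
  match n with 0 => inr (empty_clique G) | S n => inr (empty_clique (tower G n)) end.

Lemma tower_countable G n : countable_graph G -> countable_graph (tower G n).
Proof. intros H. induction n; now apply step_countable. Qed.

Lemma tower_Komega_free G n : ~ contains_Komega G -> ~ contains_Komega (tower G n).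
Proof. intros H. induction n; now apply step_Komega_free. Qed.

Lemma tower_hom_le G k n :
  k <= n -> exists f, is_hom (tower G k) (tower G n) f.
Proof.
  intros L. induction L as [|n L [f Hf]].
  - exists (fun x => x). now intros x y.
  - exists (fun x => inl (f x)). intros x y A. now apply Hf.
Qed.

(** For [k < n], [tower G k] maps into the predecessor of [tower G n]; composing would map a [step]
    to its base. *)
Lemma tower_no_hom G k n (f : vert (tower G n) -> vert (tower G k)) :
  ~ contains_Komega G -> k < n -> ~ is_hom (tower G n) (tower G k) f.
Proof.
  intros HG L Hf. destruct n as [|n]; [lia|].
  destruct (tower_hom_le G k n) as [h Hh]; [lia|].
  apply (tower_Komega_free G n HG), (step_no_hom _ (fun x => h (f x))).
  intros x y A. now apply Hh, Hf.
Qed.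

(** * Disjoint unions *)

(** Adjacency is given by equations between dependent pairs, avoiding transport between vertex
    types. *)
Definition disjoint_union (H : nat -> graph) : graph.
Proof.
  refine (Graph {n & vert (H n)}
    (fun u v => exists n x y, u = existT _ n x /\ v = existT _ n y /\ adj (H n) x y) _ _).
  - intros u v (n & x & y & Eu & Ev & A). exists n, y, x. auto using adj_sym.
  - intros u (n & x & y & -> & E & A).
    apply inj_pair2_eq_dec in E; [|exact Nat.eq_dec]. subst y.
    exact (adj_irrefl _ _ A).
Defined.

Lemma disjoint_union_adj H n x y :
  adj (disjoint_union H) (existT _ n x) (existT _ n y) <-> adj (H n) x y.
Proof.
  split.
  - intros (m & x' & y' & Ex & Ey & A). injection Ex. intros _ <-.
    apply inj_pair2_eq_dec in Ex, Ey; try exact Nat.eq_dec. congruence.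
  - intros A. exists n, x, y. auto.
Qed.

Definition index {H} (u : vert (disjoint_union H)) : nat := projT1 u.

Lemma disjoint_union_adj_index H u v :
  adj (disjoint_union H) u v -> index u = index v.
Proof. now intros (n & x & y & -> & -> & _). Qed.

(** * Hanging the pieces on one another *)

Section Tree.

(* [level] numbers the pieces of [U]; piece [n + 1] hangs at the vertex [link n],
   which lies in an earlier piece. *)
Variables (U : graph) (level : vert U -> nat) (root link : nat -> vert U).
Hypothesis level_adj : forall x y, adj U x y -> level x = level y.
Hypothesis common_neighbour : forall x y,
  level x = level y -> exists z, adj U x z /\ adj U y z.
Hypothesis level_hom_le : forall g, is_hom U U g -> forall x, level x <= level (g x).
Hypothesis level_root : forall n, level (root n) = n.
Hypothesis level_link : forall n, level (link n) <= n.
Hypothesis link_cofinal : forall x N, exists n, N <= n /\ link n = x.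

(* [inr (i, j)] is the inner vertex of the path from [link (i + j)] to
   [root (S (i + j))] with [i] inner vertices before it and [j] after it. *)
Inductive arc : vert U + nat * nat -> vert U + nat * nat -> Prop :=
| arc_piece x y : adj U x y -> arc (inl x) (inl y)
| arc_start n : arc (inl (link n)) (inr (0, n))
| arc_step i j : arc (inr (i, S j)) (inr (S i, j))
| arc_end n : arc (inr (n, 0)) (inl (root (S n))).

Definition tree_graph : graph.
Proof.
  refine (Graph (vert U + nat * nat) (fun u v => arc u v \/ arc v u) _ _).
  - tauto.
  - assert (H : forall u v, arc u v -> u <> v).
    { intros u v A. destruct A; intros E; try discriminate; injection E; try lia.
      intros ->. now apply (adj_irrefl U y). }
    intros u [A|A]; exact (H u u A eq_refl).
Defined.

Lemma tree_adj_inl x y : adj tree_graph (inl x) (inl y) <-> adj U x y.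
Proof.
  split.
  - intros [A|A]; inversion A; auto using adj_sym.
  - intros A. left. now constructor.
Qed.

(** A triangle would force the ends of a path to be equal or adjacent, but [link n] has level at
    most [n] and [root (S n)] has level [n + 1]. *)
Lemma path_vertex_no_triangle p v w :
  adj tree_graph (inr p) v -> adj tree_graph (inr p) w -> ~ adj tree_graph v w.
Proof.
  assert (NL : forall n, ~ adj U (link n) (root (S n))).
  { intros n A. apply level_adj in A. rewrite level_root in A.
    specialize (level_link n). lia. }
  assert (NE : forall n, link n <> root (S n)).
  { intros n E. specialize (level_link n). rewrite E, level_root in level_link. lia. }
  intros [A|A] [B|B] [C|C]; inversion A; subst; inversion B; subst; inversion C; subst;
    try lia; try (eapply adj_irrefl; eassumption);
    try (eapply NL; eauto using adj_sym; fail); eapply NE; eauto.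
Qed.

(* The distance to piece [S k], truncated at [k + 2]. *)
Definition piece_dist (k : nat) (v : vert tree_graph) : nat :=
  match v with
  | inl x => if level x =? S k then 0 else k + 2
  | inr (i, j) =>
      if i + j =? k then S j
      else if level (link (i + j)) =? S k then Nat.min (S i) (k + 2)
      else k + 2
  end.

(** Path [k] descends from [k + 2] to 0. A path leaving piece [S k] has number above [k], hence
    length at least [k + 3], so the truncated value [k + 2] is reached before its far end. *)
Lemma piece_dist_adj k u v :
  adj tree_graph u v -> piece_dist k u <= S (piece_dist k v).
Proof.
  assert (H : forall u v, arc u v ->
    piece_dist k u <= S (piece_dist k v) /\ piece_dist k v <= S (piece_dist k u)).
  { intros a b A. destruct A as [x y A|n|i j|n]; unfold piece_dist.
    - rewrite (level_adj x y A). lia.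
    - rewrite Nat.add_0_l. specialize (level_link n).
      destruct (Nat.eqb_spec (level (link n)) (S k)), (Nat.eqb_spec n k); lia.
    - rewrite Nat.add_succ_r, Nat.add_succ_l.
      destruct (Nat.eqb_spec (S (i + j)) k), (level (link (S (i + j))) =? S k); lia.
    - rewrite level_root, Nat.add_0_r. specialize (level_link n).
      destruct (Nat.eqb_spec n k), (Nat.eqb_spec (S n) (S k)),
        (Nat.eqb_spec (level (link n)) (S k)); lia. }
  intros [A|A]; now apply H in A.
Qed.

(** * Endomorphisms of the tree of pieces *)

Section Endomorphism.

Variable f : vert tree_graph -> vert tree_graph.
Hypothesis f_hom : is_hom tree_graph tree_graph f.

(** Every piece vertex lies in a triangle, whose image is again a triangle and so avoids path
    vertices. *)
Lemma endo_piece : exists g, is_hom U U g /\ forall x, f (inl x) = inl (g x).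
Proof.
  assert (H : forall x, exists y, f (inl x) = inl y).
  { intros x. destruct (common_neighbour x x eq_refl) as [y [A _]].
    destruct (common_neighbour x y (level_adj _ _ A)) as [z [B C]].
    apply tree_adj_inl, f_hom in A, B, C.
    destruct (f (inl x)) as [x'|p]; [eauto|].
    exfalso. exact (path_vertex_no_triangle p _ _ A B C). }
  apply functional_choice in H. destruct H as [g Hg].
  exists g. split; [|assumption].
  intros x y A. apply tree_adj_inl, f_hom in A. rewrite !Hg in A.
  now apply tree_adj_inl.
Qed.

Lemma endo_path_fixed g n :
  is_hom U U g -> (forall x, f (inl x) = inl (g x)) ->
  level (g (link n)) <> level (g (root (S n))) ->
  g (link n) = link n /\ forall i j, i + j = n -> f (inr (i, j)) = inr (i, j).
Proof.
  intros Hg fg N.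
  assert (E : exists k, n <= k /\ level (g (root (S n))) = S k).
  { pose proof (level_hom_le g Hg (root (S n))) as L. rewrite level_root in L.
    exists (pred (level (g (root (S n))))). lia. }
  destruct E as [k [Lk Ek]]. rewrite Ek in N.
  (* Walking back from the image of the root, which lies in piece [S k], each edge adds at most
     1. *)
  assert (Up : forall j i, i + j = n -> piece_dist k (f (inr (i, j))) <= S j).
  { induction j as [|j IH]; intros i Hi.
    - assert (A : adj tree_graph (inr (i, 0)) (inl (root (S n)))).
      { left. replace i with n by lia. constructor. }
      apply f_hom, (piece_dist_adj k) in A. rewrite fg in A. simpl piece_dist at 2 in A.
      rewrite Ek, Nat.eqb_refl in A. exact A.
    - assert (A : adj tree_graph (inr (i, S j)) (inr (S i, j))) by (left; constructor).
      apply f_hom, (piece_dist_adj k) in A. specialize (IH (S i)). lia. }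
  (* Walking forward from [g (link n)], which has the full value [k + 2] by [N], each edge loses at
     most 1. *)
  assert (Lo : forall i j, i + j = n -> k < piece_dist k (f (inr (i, j))) + i).
  { induction i as [|i IH]; intros j Hj.
    - assert (A : adj tree_graph (inl (link n)) (inr (0, j))).
      { left. replace j with n by lia. constructor. }
      apply f_hom, (piece_dist_adj k) in A. rewrite fg in A. simpl piece_dist at 1 in A.
      apply Nat.eqb_neq in N. rewrite N in A. lia.
    - assert (A : adj tree_graph (inr (i, S j)) (inr (S i, j))) by (left; constructor).
      apply f_hom, (piece_dist_adj k) in A. specialize (IH (S j)). lia. }
  (* At the last inner vertex the two bounds give [k < n + 1]. With [k = n] they coincide, so the
     image path descends at every edge. *)
  assert (k = n) as ->.
  { specialize (Up 0 n). specialize (Lo n 0). lia. }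
  assert (D : forall i j, i + j = n -> piece_dist n (f (inr (i, j))) = S j).
  { intros i j Hij. specialize (Up j i Hij). specialize (Lo i j Hij). lia. }
  clear Up Lo Lk.
  (* Outside piece [S n], a piece vertex has a neighbour of value [n + 1] only if it is [link n],
     the neighbour being the first vertex of path [n]. *)
  assert (First : g (link n) = link n /\ f (inr (0, n)) = inr (0, n)).
  { assert (A : adj tree_graph (inl (link n)) (inr (0, n))) by (left; constructor).
    apply f_hom in A. rewrite fg in A. specialize (D 0 n eq_refl).
    destruct (f (inr (0, n))) as [x|[i j]]; unfold piece_dist in D.
    - destruct (level x =? S n); lia.
    - destruct A as [A|A]; inversion A; subst.
      + rewrite Nat.add_0_l in D. destruct (Nat.eqb_spec j n) as [->|]; [auto|].
        destruct (Nat.eqb_spec (level (link j)) (S n)); [congruence|lia].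
      + rewrite Nat.add_0_r in D.
        match goal with E : root _ = _ |- _ => rewrite <- E, level_root in N end.
        specialize (level_link i).
        destruct (Nat.eqb_spec i n); [congruence|].
        destruct (Nat.eqb_spec (level (link i)) (S n)); lia. }
  destruct First as [F1 F2]. split; [exact F1|].
  (* From a vertex of path [n], only the next vertex along the path has a smaller value. *)
  induction i as [|i IH]; intros j Hij; simpl in Hij.
  - now subst j.
  - assert (A : adj tree_graph (inr (i, S j)) (inr (S i, j))) by (left; constructor).
    apply f_hom in A. rewrite (IH (S j)) in A by lia. specialize (D (S i) j Hij).
    destruct A as [A|A]; inversion A; subst.
    + reflexivity.
    + exfalso. match goal with E : _ = f _ |- _ => rewrite <- E in D end.
      simpl in D. specialize (level_link (S j)).
      destruct (Nat.eqb_spec (level (link (S j))) (S (S j))); lia.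
    + exfalso. match goal with E : _ = f _ |- _ => rewrite <- E in D end.
      simpl in D. rewrite (proj2 (Nat.eqb_eq _ _)) in D; lia.
Qed.

End Endomorphism.

(** At [x], take a path with [n] at least [level (g x)]: the image of its root has level at least
    [n + 1], so its ends go to different pieces. Once [g] is the identity, this holds for every
    path. *)
Lemma tree_graph_rigid : rigid tree_graph.
Proof.
  intros f Hf. destruct (endo_piece f Hf) as [g [Hg fg]].
  assert (Gid : forall x, g x = x).
  { intros x. destruct (link_cofinal x (level (g x))) as [n [Ln <-]].
    apply (endo_path_fixed f Hf g n Hg fg).
    pose proof (level_hom_le g Hg (root (S n))) as L. rewrite level_root in L. lia. }
  intros [x|[i j]].
  - rewrite fg. now rewrite Gid.
  - apply (endo_path_fixed f Hf g (i + j) Hg fg); [|reflexivity].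
    rewrite !Gid, level_root. specialize (level_link (i + j)). lia.
Qed.

Lemma tree_graph_countable : countable_graph U -> countable_graph tree_graph.
Proof. intros H. apply countable_sum; [exact H|apply countable_nat_prod]. Qed.

End Tree.

(** * Choice of the attachment vertices, and the conclusion *)

Lemma exists_link A (level : A -> nat) (a0 : A) :
  countable A -> level a0 = 0 ->
  exists link : nat -> A, (forall n, level (link n) <= n) /\
    forall a N, exists n, N <= n /\ link n = a.
Proof.
  intros HA H0. destruct (countable_enum A a0 HA) as [e He].
  (* The first coordinate of a pair code repeats every element infinitely often; [a0], of level 0,
     replaces those whose level is still too high. *)
  exists (fun n => let a := e (fst (of_nat n)) in if level a <=? n then a else a0). split.
  - intros n; simpl. destruct (Nat.leb_spec (level (e (fst (of_nat n)))) n); lia.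
  - intros a N. destruct (He a) as [i Hi].
    (* A code is at least the sum of its coordinates, so this [n] is at least both [N] and
       [level a]. *)
    set (n := to_nat (i, N + level a)). exists n.
    assert (L : N + level a + i <= n) by apply to_nat_non_decreasing.
    split; [lia|]. unfold n at 1. rewrite cancel_of_to; simpl. rewrite Hi.
    destruct (Nat.leb_spec (level a) n); [reflexivity|lia].
Qed.

Theorem theorem4 :
  forall G : graph,
    countable_graph G -> ~ contains_Komega G ->
    exists G' : graph,
      countable_graph G' /\ rigid G' /\ induced_subgraph G G'.
Proof.
  intros G HC HK.
  (* The shift makes each piece the [step] of a nonempty graph, as [step_common_neighbour]
     requires. *)
  set (H := fun n => tower G (S n)).
  set (U := disjoint_union H).
  set (root := fun n => existT (fun n => vert (H n)) n (tower_root G (S n)) : vert U).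
  assert (UC : countable_graph U).
  { apply countable_sigT. intros n. now apply tower_countable. }
  assert (CN : forall x y : vert U, index x = index y -> exists z, adj U x z /\ adj U y z).
  { intros [n x] [m y] E. simpl in E. subst m.
    destruct (step_common_neighbour (tower G n) (tower_root G n) x y) as [z [A B]].
    exists (existT _ n z). split; now apply disjoint_union_adj. }
  assert (UP : forall g, is_hom U U g -> forall x, index x <= index (g x)).
  { intros g Hg [n x0]. apply Nat.nlt_ge. intros L.
    set (k := index (g (existT _ n x0))) in *.
    (* Common neighbours force all of piece [n] into the single piece [k], giving a homomorphism
       between towers. *)
    assert (P : forall x, exists y, g (existT _ n x) = existT (fun n => vert (H n)) k y).
    { intros x. destruct (CN (existT _ n x0) (existT _ n x) eq_refl) as [z [A B]].
      apply Hg, disjoint_union_adj_index in A, B. fold k in A. rewrite <- B in A.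
      destruct (g (existT _ n x)) as [m y]. simpl in A. rewrite A. now exists y. }
    apply functional_choice in P. destruct P as [h Hh].
    apply (tower_no_hom G (S k) (S n) h HK); [simpl in L; lia|].
    intros x y A. apply (disjoint_union_adj H k). rewrite <- !Hh.
    apply Hg, disjoint_union_adj, A. }
  destruct (exists_link (vert U) index (root 0) UC eq_refl) as [link [L1 L2]].
  exists (tree_graph U root link). split; [|split].
  - now apply tree_graph_countable.
  - apply (tree_graph_rigid U index root link); auto.
    apply disjoint_union_adj_index.
  (* Piece 0 is [step (step G)]; each [inl] includes a graph in its join without adding edges. *)
  - exists (fun x => inl (existT (fun n => vert (H n)) 0 (inl (inl x)))). split.
    + intros x y E.
      apply (f_equal (fun v : vert U + nat * nat =>
                        match v with inl u => u | inr _ => root 0 end)) in E.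
      apply inj_pair2_eq_dec in E; [congruence|exact Nat.eq_dec].
    + intros x y. symmetry. etransitivity; [apply tree_adj_inl|].
      apply (disjoint_union_adj H 0 (inl (inl x)) (inl (inl y))).
Qed.
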